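(* Let $G=(V,E)$ be a finite connected graph with vertices $v_1,\dots,v_n$, $n=|V|$, and distance matrix $D=(d(v_i,v_j))_{i,j=1}^n$. Suppose $w\in\mathbb{R}^n$ satisfies $Dw=n\cdot\mathbf{1}$ and $\min_i w_i\ge 0$. Then $$\|w\|_{\ell^1}\ge \frac{n^2}{n-1}\cdot\frac{1}{\operatorname{diam}(G)},$$ with equality if and only if $G=K_n$ is the complete graph on $n$ vertices.
   Context: Graphs are finite, simple, undirected and unweighted; $d(u,v)$ is the shortest-path (combinatorial) distance, $\operatorname{diam}(G)=\max_{u,v}d(u,v)$, $\mathbf{1}\in\mathbb{R}^n$ is the all-ones vector, and $\|w\|_{\ell^1}=\sum_i|w_i|$. (The equation $Dw=n\cdot\mathbf{1}$ forces $n\ge 2$.) *)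

(* Defs.v *)
From HB Require Import structures.
From mathcomp Require Import all_boot all_order all_algebra.
From mathcomp Require Import reals.

Set Implicit Arguments.
Unset Strict Implicit.
Unset Printing Implicit Defensive.

Import Order.TTheory GRing.Theory Num.Theory.
Local Open Scope ring_scope.

Record sgraph := SGraph {
  vertex :> finType;
  adj : rel vertex;
  adj_sym : symmetric adj;
  adj_irrefl : irreflexive adj
}.

Definition has_walk (G : sgraph) (u v : G) (k : nat) : bool :=
  [exists p : k.-tuple G, path (@adj G) u p && (last u p == v)].

(* In a graph on #|G| vertices a shortest walk has fewer than #|G| edges, so
   bounding k loses nothing; #|G| is the junk value for vertices in different
   components. Lemmas dist_walk and dist_min characterize the result. *)
Definition dist (G : sgraph) (u v : G) : nat :=
  \big[minn/#|G|]_(k < #|G| | has_walk u v k) (k : nat).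

Definition connected (G : sgraph) : Prop :=
  (0 < #|G|)%N /\ forall u v : G, connect (@adj G) u v.

Definition diam (G : sgraph) : nat := (\max_(u : G) \max_(v : G) dist u v)%N.

Definition complete (G : sgraph) : Prop :=
  forall u v : G, adj u v = (u != v).

Definition distmx (R : realType) (G : sgraph) (n : nat) (v : 'I_n -> G) :
  'M[R]_n := \matrix_(i, j) (dist (v i) (v j))%:R.

Definition l1norm (R : realType) (n : nat) (w : 'cV[R]_n) : R :=
  \sum_i `|w i 0|.

Lemma has_walkP (G : sgraph) (u v : G) (k : nat) :
  reflect (exists p : seq G, [/\ size p = k, path (@adj G) u p & last u p = v])
          (has_walk u v k).
Proof.
apply: (iffP existsP) => [[p /andP[pp /eqP pl]]|[p [/eqP ps pp pl]]].
  by exists p; rewrite size_tuple.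
by exists (Tuple ps); rewrite /= pp pl eqxx.
Qed.

Lemma dist_le (G : sgraph) (u v : G) (k : nat) :
  has_walk u v k -> (k < #|G|)%N -> (dist u v <= k)%N.
Proof.
move=> wk kG; rewrite /dist.
elim: (index_enum _) (mem_index_enum (Ordinal kG)) => [//|i r IH].
rewrite inE big_cons => /orP[/eqP <-|/IH le_k]; first by rewrite wk geq_minl.
by case: ifP => // _; apply: leq_trans le_k; apply: geq_minr.
Qed.

Lemma dist_min (G : sgraph) (u v : G) (p : seq G) :
  path (@adj G) u p -> last u p = v -> (dist u v <= size p)%N.
Proof.
move=> pp pl; case: (shortenP pp) pl => q pq uq sq ql.
have sqp : (size q <= size p)%N by apply: uniq_leq_size sq; case/andP: uq.
apply: leq_trans sqp; apply: dist_le; first by apply/has_walkP; exists q.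
by rewrite -[(size q).+1]/(size (u :: q)) -(card_uniqP uq) max_card.
Qed.

Lemma dist_walk (G : sgraph) (u v : G) :
  connect (@adj G) u v ->
  exists p : seq G, [/\ size p = dist u v, path (@adj G) u p & last u p = v].
Proof.
move=> /connectP[p pp pl]; case: (shortenP pp) pl => q pq uq _ /esym ql.
have qG : (size q < #|G|)%N.
  by rewrite -[(size q).+1]/(size (u :: q)) -(card_uniqP uq) max_card.
have wq : has_walk u v (size q) by apply/has_walkP; exists q.
have dG : (dist u v < #|G|)%N by apply: leq_ltn_trans (dist_le wq qG) qG.
apply/has_walkP; move: dG; rewrite /dist.
apply: (big_ind (fun d => (d < #|G|)%N -> has_walk u v d)) => //.
  by rewrite ltnn.
by move=> x y hx hy; rewrite /minn; case: ifP.
Qed.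

(* Main.v *)
Require Import Defs.
From mathcomp Require Import all_boot all_order all_algebra.
From mathcomp Require Import reals.
Import Order.TTheory GRing.Theory Num.Theory.
Local Open Scope ring_scope.

(** Write [S] for the sum of the nonnegative weights, so that [S] is the l1
    norm of [w].  Row [i] of [D w = n 1] says [n = \sum_(j != i) d(i, j) w_j],
    and each distance is at most the diameter, so [n] is at most
    [diam * (S - w_i)].  Summing over the [n] rows gives
    [n ^ 2 <= diam * (n - 1) * S], which is the bound.  [distance_deficit]
    keeps the error term: [diam * (n - 1) * S - n ^ 2] is the sum over ordered
    pairs of distinct vertices of [(diam - d(i, j)) * w_j], all of whose terms
    are nonnegative.

    Equality thus holds exactly when every term vanishes.  In a complete graph
    all distances between distinct vertices equal the diameter, so they do.
    Conversely, [w] is not zero, so some [w_j] is positive, and then every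
    other vertex is at distance [diam] from [v_j].  As [v_j] has a neighbour
    ([adj_exists]), this common distance is 1, and a connected graph of diameter
    1 is complete ([diam1_complete]). *)

Lemma distxx (G : sgraph) (u : G) : dist u u = 0%N.
Proof. by apply/eqP; rewrite -leqn0; apply: (@dist_min _ _ _ [::]). Qed.

Lemma dist_gt0 (G : sgraph) (u v : G) :
  connect (@adj G) u v -> u != v -> (0 < dist u v)%N.
Proof.
move=> /dist_walk[p [<- _ pl]]; case: p pl => [/= ->|//]; by rewrite eqxx.
Qed.

Lemma dist_eq1 (G : sgraph) (u v : G) :
  connect (@adj G) u v -> (dist u v == 1%N) = adj u v.
Proof.
move=> uv; apply/eqP/idP => [d1|auv].
  have [p [+ pp pl]] := dist_walk uv; rewrite d1.
  case: p pp pl => [|x [|y p]] //=; rewrite andbT => aux <- _ //.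
apply/eqP; rewrite eqn_leq dist_gt0 //.
  by rewrite andbT (@dist_min _ _ _ [:: v]) //= auv.
by apply: contraTneq auv => ->; rewrite adj_irrefl.
Qed.

Lemma dist_le_diam (G : sgraph) (u v : G) : (dist u v <= diam G)%N.
Proof.
apply: leq_trans (leq_bigmax u).
exact: (@leq_bigmax _ (fun x => dist u x) v).
Qed.

Lemma diam1_complete (G : sgraph) :
  connected G -> diam G = 1%N -> complete G.
Proof.
move=> [_ conn] d1 u v; have [->|uv] := eqVneq u v; first exact: adj_irrefl.
by rewrite -dist_eq1 // eqn_leq dist_gt0 // -{1}d1 dist_le_diam.
Qed.

Lemma complete_dist (G : sgraph) (u v : G) :
  complete G -> dist u v = (u != v)%N.
Proof.
move=> cG; have [->|uv] := eqVneq u v; first exact: distxx.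
have auv : adj u v by rewrite cG.
by apply/eqP; rewrite dist_eq1 // connect1.
Qed.

Lemma complete_diam (G : sgraph) (u v : G) :
  complete G -> u != v -> diam G = 1%N.
Proof.
move=> cG uv; apply/eqP; rewrite eqn_leq; apply/andP; split.
  apply/bigmax_leqP => x _; apply/bigmax_leqP => y _.
  by rewrite complete_dist // leq_b1.
by apply: leq_trans (dist_le_diam _ u v); rewrite complete_dist // uv.
Qed.

Lemma adj_exists (G : sgraph) (u v : G) :
  connect (@adj G) u v -> u != v -> exists x, adj u x.
Proof.
move=> /connectP[[|x p] /= pp ->]; first by rewrite eqxx.
by case/andP: pp => ux _ _; exists x.
Qed.

(** The subtracted distances sum to [n ^ 2], since each of the [n] rows of
    [D w = n 1] contributes [n]; the constant [c] meets each weight [w_j] once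
    for every index other than [j], that is [n - 1] times.  For [c] the
    diameter and [w] nonnegative, the left side has only nonnegative terms. *)
Lemma distance_deficit (R : realType) (G : sgraph) (n : nat) (v : 'I_n -> G)
    (w : 'cV[R]_n) (c : R) :
  distmx R v *m w = n%:R *: const_mx 1 ->
  \sum_i \sum_(j | i != j) (c - (dist (v i) (v j))%:R) * w j 0 =
  c * (n%:R - 1) * (\sum_j w j 0) - n%:R ^+ 2.
Proof.
move=> Dw.
have row i : \sum_(j | i != j) (dist (v i) (v j))%:R * w j 0 = n%:R.
  have := congr1 (fun A : 'cV_n => A i 0) Dw.
  rewrite !mxE mulr1 => <-; rewrite [RHS](bigD1 i) //= mxE distxx mul0r add0r.
  by apply: eq_big => j; [rewrite eq_sym|rewrite mxE].
under eq_bigr => i _ do under eq_bigr => j _ do rewrite mulrBl.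
under eq_bigr => i _ do rewrite sumrB row.
rewrite sumrB sumr_const card_ord -[n%:R *+ n]mulr_natl -expr2; congr (_ - _).
under eq_bigr => i _ do rewrite big_mkcond.
rewrite exchange_big mulr_sumr; apply: eq_bigr => j _ /=.
rewrite -big_mkcond sumr_const (cardC1 j) card_ord -[LHS]mulr_natr mulrAC.
congr (_ * _); congr (_ * _).
by rewrite -subn1 natrB // (leq_trans _ (ltn_ord j)).
Qed.

Theorem theorem2 (R : realType) (G : sgraph) (n : nat) (v : 'I_n -> G)
    (w : 'cV[R]_n) (v_bij : bijective v) (G_conn : connected G)
    (Dw : distmx R v *m w = n%:R *: const_mx 1)
    (w_ge0 : forall i, 0 <= w i 0) :
  n%:R ^+ 2 / (n%:R - 1) * (1 / (diam G)%:R) <= l1norm w /\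
  (l1norm w = n%:R ^+ 2 / (n%:R - 1) * (1 / (diam G)%:R) <-> complete G).
Proof.
have [G_gt0 conn] := G_conn.
have v_inj := bij_inj v_bij.
have n_gt0 : (0 < n)%N.
  by rewrite -(card_ord n) (bij_eq_card v_bij).
have row i : \sum_j (dist (v i) (v j))%:R * w j 0 = n%:R.
  have := congr1 (fun A : 'cV_n => A i 0) Dw; rewrite !mxE mulr1 => <-.
  by apply: eq_bigr => j _; rewrite mxE.
have nR_neq0 : n%:R != 0 :> R by rewrite pnatr_eq0 -lt0n.
(* Some term of a row is nonzero: this yields both a positive weight and a
   second vertex, as the diagonal distances vanish. *)
have [i [j [ij wj]]] : exists i j, i != j /\ 0 < w j 0.
  pose i := Ordinal n_gt0; exists i.
  have [/existsP[j /andP[ij wj]]|/existsPn none] :=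
    boolP [exists j, (i != j) && (0 < w j 0)]; first by exists j.
  case/eqP: nR_neq0; rewrite -(row i); apply: big1 => j _.
  have := none j; have [<-|ij] := eqVneq i j; first by rewrite distxx mul0r.
  rewrite /= lt_neqAle w_ge0 andbT negbK => /eqP <-; exact: mulr0.
have vij : v i != v j by rewrite (inj_eq v_inj).
have n_gt1 : (1 < n)%N.
  rewrite -(card_ord n); apply/card_gt1P; by exists i, j.
have d_gt0 : 0 < (diam G)%:R :> R.
  by rewrite ltr0n (leq_trans _ (dist_le_diam _ (v i) (v j))) // dist_gt0.
have n1_gt0 : 0 < n%:R - 1 :> R by rewrite subr_gt0 ltr1n.
have -> : l1norm w = \sum_k w k 0.
  by apply: eq_bigr => k _; rewrite ger0_norm.
have := @distance_deficit R G n v w (diam G)%:R Dw.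
set gap := \sum_i _; set S := \sum_k _ => gapE.
have term_ge0 k l : 0 <= ((diam G)%:R - (dist (v k) (v l))%:R) * w l 0.
  by rewrite mulr_ge0 // subr_ge0 ler_nat dist_le_diam.
have gap_ge0 : 0 <= gap by apply: sumr_ge0 => k _; apply: sumr_ge0.
have SE : S = (gap + n%:R ^+ 2) / ((diam G)%:R * (n%:R - 1)).
  by rewrite gapE subrK mulrC mulKf // mulf_neq0 // gt_eqF.
have -> : n%:R ^+ 2 / (n%:R - 1) * (1 / (diam G)%:R) =
          n%:R ^+ 2 / ((diam G)%:R * (n%:R - 1)) :> R.
  by rewrite mul1r -mulrA -invfM mulrC [X in _ / X]mulrC mulrC.
have dn_gt0 : 0 < (diam G)%:R * (n%:R - 1) :> R by rewrite mulr_gt0.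
split; first by rewrite SE ler_pM2r ?invr_gt0 // lerDr.
split=> [eqS|cG]; last first.
  rewrite SE (_ : gap = 0) ?add0r //; apply: big1 => k _; apply: big1 => l kl.
  rewrite (complete_diam _ _ _ cG vij) complete_dist //.
  by rewrite (inj_eq v_inj) kl subrr mul0r.
have gap0 : gap = 0.
  apply: (addIr (n%:R ^+ 2)); rewrite add0r.
  by apply: (mulIf (invr_neq0 (lt0r_neq0 dn_gt0))); rewrite -SE.
have dist_diam k : k != j -> dist (v k) (v j) = diam G.
  move=> kj; have /psumr_eq0P gap_rows := gap0.
  have /psumr_eq0P terms :=
    gap_rows (fun k _ => sumr_ge0 _ (fun l _ => term_ge0 k l)) k isT.
  have /eqP := terms (fun l _ => term_ge0 k l) j kj.
  by rewrite mulf_eq0 (gt_eqF wj) orbF subr_eq0 eqr_nat => /eqP.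
apply: diam1_complete => //.
have [x ajx] : exists x, adj (v j) x.
  by apply: (adj_exists _ _ (v i)); rewrite // eq_sym.
have [v' _ vK] := v_bij.
have xE := vK x.
rewrite -(dist_diam (v' x)); first by apply/eqP; rewrite xE dist_eq1 // adj_sym.
by apply: contraTneq ajx => <-; rewrite xE adj_irrefl.
Qed.
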